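(* Let $\{A_0=I_{n-1}, A_1, A_2={}^tA_1\}$ be a non-symmetric association scheme of rank $3$ and order $n-1$, and let $\sigma_k$ ($k\in K$) and $\tau_g$ ($g\in G\setminus K$) be the $4n\times 4n$ matrices constructed from it in the context. Then the set $\mathcal{Q}=\{\sigma_k\mid k\in K\}\cup\{\tau_g\mid g\in G\setminus K\}$ forms an association scheme.
   Context: ${}^tM$ is the transpose of $M$, $I_N$ the $N\times N$ identity matrix, $J_N$ the $N\times N$ all-ones matrix, $\otimes$ the Kronecker product. Association scheme: a set $\mathcal{S}=\{S_0,\dots,S_d\}$ of $d+1$ non-zero $N\times N$ matrices with entries in $\{0,1\}$ is an association scheme of order $N$ and rank $d+1$ if (1) $S_0=I_N$; (2) $\sum_{i=0}^d S_i=J_N$; (3) for all $0\le i,j\le d$, ${}^tS_i$ and $S_iS_j$ are linear combinations of $S_0,\dots,S_d$. It is symmetric if ${}^tS_i=S_i$ for all $i$, and non-symmetric otherwise. Group: let $x,y$ be the permutation matrices $$x=\begin{pmatrix}0&1&0&0\\0&0&1&0\\0&0&0&1\\1&0&0&0\end{pmatrix},\quad y=\begin{pmatrix}0&1&0&0\\1&0&0&0\\0&0&0&1\\0&0&1&0\end{pmatrix}$$ and $G=\langle x,y\rangle\cong D_8$ the group of order $8$ generated by them under matrix multiplication; its identity is $1=I_4$. Let $K=C_G(x)=\{1,x,x^2,x^3\}$, so $G\setminus K=\{y,xy,x^2y,x^3y\}$. Construction of $\mathcal{Q}$: given the scheme $\{A_0,A_1,A_2\}$ of order $n-1$ (it is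 known that then $n\equiv 0\pmod 4$), define $n\times n$ block matrices (blocks of sizes $1$ and $n-1$; $\mathbf{1}$ is the all-ones row vector of length $n-1$) $$\hat{A}_1=\begin{pmatrix}0&\mathbf{1}\\ 0&A_1\end{pmatrix},\qquad \hat{A}_2=\begin{pmatrix}0&0\\ {}^t\mathbf{1}&A_2\end{pmatrix}.$$ Define $4n\times 4n$ matrices $\sigma_k=I_n\otimes k$ for $k\in K$ and $\tau_g=\hat{A}_1\otimes g+\hat{A}_2\otimes gx^2$ for $g\in G\setminus K$. *)

(* Defs.v *)
From mathcomp Require Import all_boot all_order all_algebra.
From mathcomp Require Import classical_sets.
From mathcomp.real_closed Require Export mxtens.
Set Implicit Arguments.
Unset Strict Implicit.
Unset Printing Implicit Defensive.
Import Order.TTheory GRing.Theory Num.Theory.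
Local Open Scope classical_set_scope.
Local Open Scope ring_scope.

(* Matrices have entries in an arbitrary numFieldType F (so a field of
   characteristic 0, such as rat or algC), which is also the field of scalars
   of the linear combinations. *)

Definition lin_comb (F : numFieldType) (N d : nat)
    (S : 'I_d.+1 -> 'M[F]_N) (M : 'M[F]_N) : Prop :=
  exists c : 'I_d.+1 -> F, M = \sum_(i < d.+1) c i *: S i.

(* S_0, ..., S_d, listed without repetition, form an association scheme of
   order N and rank d + 1. *)
Definition assoc_scheme (F : numFieldType) (N d : nat)
    (S : 'I_d.+1 -> 'M[F]_N) : Prop :=
  [/\ injective S,
      forall i, S i != 0,
      forall i a b, (S i a b == 0) || (S i a b == 1)
    & [/\ S ord0 = 1%:M,
          \sum_(i < d.+1) S i = const_mx 1,
          forall i, lin_comb S (S i)^T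
        & forall i j, lin_comb S (S i *m S j)]].

Definition symmetric_scheme (F : numFieldType) (N d : nat)
    (S : 'I_d.+1 -> 'M[F]_N) : Prop :=
  forall i, (S i)^T = S i.

(* An unindexed set of matrices is an association scheme when its elements can
   be numbered so as to form one. *)
Definition is_assoc_scheme (F : numFieldType) (N : nat)
    (Q : set 'M[F]_N) : Prop :=
  exists (d : nat) (S : 'I_d.+1 -> 'M[F]_N), range S = Q /\ assoc_scheme S.

Definition mx_of_rows (F : numFieldType) (N : nat)
    (rows : seq (seq nat)) : 'M[F]_N :=
  \matrix_(i < N, j < N) (nth 0%N (nth [::] rows i) j)%:R.

Definition mx_x (F : numFieldType) : 'M[F]_4 :=
  mx_of_rows F 4 [:: [:: 0; 1; 0; 0];
                     [:: 0; 0; 1; 0];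
                     [:: 0; 0; 0; 1];
                     [:: 1; 0; 0; 0]]%N.

Definition mx_y (F : numFieldType) : 'M[F]_4 :=
  mx_of_rows F 4 [:: [:: 0; 1; 0; 0];
                     [:: 1; 0; 0; 0];
                     [:: 0; 0; 0; 1];
                     [:: 0; 0; 1; 0]]%N.

(* Membership in <x, y>: the library's generated subgroups <<_>> live in a
   finGroupType, which the matrices over the infinite field F do not form. *)
Inductive in_G (F : numFieldType) : 'M[F]_4 -> Prop :=
  | in_G_one : in_G 1%:M
  | in_G_x : in_G (mx_x F)
  | in_G_y : in_G (mx_y F)
  | in_G_mul g h : in_G g -> in_G h -> in_G (g *m h)
  | in_G_inv g : in_G g -> in_G (invmx g).

Definition grpG (F : numFieldType) : set 'M[F]_4 := [set g | in_G g].

Definition grpK (F : numFieldType) : set 'M[F]_4 :=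
  [set g | grpG g /\ g *m mx_x F = mx_x F *m g].

(* Below n = 1 + m, where m = n - 1 is the order of the given scheme. *)

Definition hatA1 (F : numFieldType) (m : nat) (A1 : 'M[F]_m) : 'M[F]_(1 + m) :=
  block_mx (0 : 'M_1) (const_mx 1) 0 A1.

Definition hatA2 (F : numFieldType) (m : nat) (A2 : 'M[F]_m) : 'M[F]_(1 + m) :=
  block_mx (0 : 'M_1) 0 (const_mx 1 : 'rV_m)^T A2.

(* *t is the Kronecker product. *)
Definition sigma (F : numFieldType) (m : nat) (k : 'M[F]_4)
    : 'M[F]_((1 + m) * 4) :=
  (1%:M : 'M_(1 + m)) *t k.

Definition tau (F : numFieldType) (m : nat) (A1 A2 : 'M[F]_m) (g : 'M[F]_4)
    : 'M[F]_((1 + m) * 4) :=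
  hatA1 A1 *t g + hatA2 A2 *t (g *m (mx_x F *m mx_x F)).

Definition schemeQ (F : numFieldType) (m : nat) (A1 A2 : 'M[F]_m)
    : set 'M[F]_((1 + m) * 4) :=
  [set sigma m k | k in @grpK F] `|`
  [set tau A1 A2 g | g in @grpG F `\` @grpK F].

(* Main.v *)
Require Import Defs.
From mathcomp Require Import all_boot all_order all_algebra.
From mathcomp Require Import classical_sets.
From mathcomp Require Import ring.
Set Implicit Arguments.
Unset Strict Implicit.
Unset Printing Implicit Defensive.
Import Order.TTheory GRing.Theory Num.Theory.
Local Open Scope ring_scope.

(* Write T = A_1 and P = hatA_1. Since T + T^T = J - I and T T^T is a
   combination of I, T and T^T, T is a doubly regular tournament, and adding a
   dominating vertex gives P + P^T = J - I together with
     P P + P^T P^T = a (J - I),   P P^T + P^T P = m I + a (J - I).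
   Hence, for reflections g and h of the dihedral group G,
     tau_g tau_h = m sigma_(g h x^2) + a (J - I) (x) (g h + g h x^2),
   and the coincidences 1 + x^2 = x y + x^3 y and x + x^3 = y + x^2 y turn the
   last term into a (tau_r + tau_(r x^2)) for some reflection r. *)

(** * Kronecker product identities *)

Lemma tensmxDl (R : comPzRingType) m n p q
    (A B : 'M[R]_(m, n)) (C : 'M[R]_(p, q)) :
  (A + B) *t C = A *t C + B *t C.
Proof. by apply/matrixP=> i j; rewrite !mxE mulrDl. Qed.

Lemma tensmxDr (R : comPzRingType) m n p q
    (A : 'M[R]_(m, n)) (B C : 'M[R]_(p, q)) :
  A *t (B + C) = A *t B + A *t C.
Proof. by apply/matrixP=> i j; rewrite !mxE mulrDr. Qed.

Lemma tensmxZl (R : comPzRingType) m n p q c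
    (A : 'M[R]_(m, n)) (B : 'M[R]_(p, q)) :
  (c *: A) *t B = c *: (A *t B).
Proof. by apply/matrixP=> i j; rewrite !mxE mulrA. Qed.

Lemma tensmx_sumr (R : comPzRingType) (I : finType) m n p q
    (A : 'M[R]_(m, n)) (B : I -> 'M[R]_(p, q)) :
  \sum_i A *t B i = A *t (\sum_i B i).
Proof.
apply/matrixP=> i j; rewrite summxE !mxE summxE mulr_sumr.
by apply: eq_bigr => k _; rewrite mxE.
Qed.

Lemma tens1mx1 (R : comPzRingType) m n :
  (1%:M : 'M[R]_m) *t (1%:M : 'M[R]_n) = 1%:M.
Proof.
apply/matrixP=> i j; rewrite !mxE -natrM mulnb.
by rewrite -[in RHS](can_eq (@mxtens_unindexK m n)).
Qed.

Lemma tens_const_mx (R : comPzRingType) m n p q (a b : R) :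
  (const_mx a : 'M_(m, n)) *t (const_mx b : 'M_(p, q)) = const_mx (a * b).
Proof. by apply/matrixP=> i j; rewrite !mxE. Qed.

(** * Linear combinations and distinctness within a scheme *)

Lemma lin_combD (F : numFieldType) N d (S : 'I_d.+1 -> 'M[F]_N) M M' :
  lin_comb S M -> lin_comb S M' -> lin_comb S (M + M').
Proof.
move=> [c ->] [c' ->]; exists (fun i => c i + c' i).
by rewrite -big_split; apply: eq_bigr => i _; rewrite scalerDl.
Qed.

Lemma lin_combZ (F : numFieldType) N d (S : 'I_d.+1 -> 'M[F]_N) a M :
  lin_comb S M -> lin_comb S (a *: M).
Proof.
move=> [c ->]; exists (fun i => a * c i).
by rewrite scaler_sumr; apply: eq_bigr => i _; rewrite scalerA.
Qed.

Lemma lin_comb_gen (F : numFieldType) N d (S : 'I_d.+1 -> 'M[F]_N) i :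
  lin_comb S (S i).
Proof.
exists (fun j => (j == i)%:R); rewrite (bigD1 i) //= eqxx scale1r.
by rewrite big1 ?addr0 // => j /negPf ->; rewrite scale0r.
Qed.

(** Two equal members at different indices share an entry 1, so the sum there would be at least 2,
    the remaining terms being nonnegative. *)
Lemma sum_const1_injective (F : numFieldType) N d (S : 'I_d.+1 -> 'M[F]_N) :
    (forall i, S i != 0) -> (forall i a b, (S i a b == 0) || (S i a b == 1)) ->
  \sum_i S i = const_mx 1 -> injective S.
Proof.
move=> S0 S01 sumS i j eqS; apply/eqP/negPn/negP => neq_ij.
case: (pickP (fun ab => S i ab.1 ab.2 != 0)) => [[a b] /= Sab|S_0]; last first.
  case/eqP: (S0 i); apply/matrixP=> a b; rewrite mxE.
  by apply/eqP; move/(_ (a, b)): S_0 => /= /negbFE.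
have Sab1 : S i a b = 1 by case/orP: (S01 i a b) Sab => /eqP-> //; rewrite eqxx.
have := congr1 (fun M : 'M_N => M a b) sumS.
rewrite summxE mxE (bigD1 i) //= (bigD1 j) 1?eq_sym //= -eqS Sab1.
rewrite -[RHS]addr0 => /addrI/eqP; apply/negP; rewrite lt0r_neq0 //.
rewrite ltr_wpDr // sumr_ge0 // => k _.
by case/orP: (S01 k a b) => /eqP ->.
Qed.

(** * Matrices of functions and the dihedral group *)

Definition fun_mx (F : numFieldType) n (f : 'I_n -> 'I_n) : 'M[F]_n :=
  \matrix_(i, j) (j == f i)%:R.

Lemma eq_fun_mx (F : numFieldType) n (f g : 'I_n -> 'I_n) :
  f =1 g -> fun_mx F f = fun_mx F g.
Proof. by move=> fg; apply/matrixP=> i j; rewrite !mxE fg. Qed.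

(** Row i has its only 1 in column [f i], hence the reversed order of composition. *)
Lemma fun_mxM (F : numFieldType) n (f g : 'I_n -> 'I_n) :
  fun_mx F f *m fun_mx F g = fun_mx F (g \o f).
Proof.
apply/matrixP=> i j; rewrite !mxE (bigD1 (f i)) //= !mxE eqxx mul1r.
by rewrite big1 ?addr0 // => k /negPf kf; rewrite !mxE kf mul0r.
Qed.

Lemma fun_mx_inj (F : numFieldType) n (f g : 'I_n -> 'I_n) :
  fun_mx F f = fun_mx F g -> f =1 g.
Proof.
move=> /matrixP fg i; have := fg i (f i); rewrite !mxE eqxx => /esym/eqP.
by case: (f i =P g i) => // _; rewrite eq_sym oner_eq0.
Qed.

(* With rows and columns indexed modulo 4, [rot_mx i] is x^i and [refl_mx i]
   is x^(1 - i) y. *)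
Definition rot_mx (F : numFieldType) (i : 'I_4) := fun_mx F (fun a => a + i).

Definition refl_mx (F : numFieldType) (i : 'I_4) := fun_mx F (fun a => i - a).

Lemma mx_xE (F : numFieldType) : mx_x F = rot_mx F 1.
Proof.
apply/matrixP=> i j; rewrite !mxE.
by case: i j => [[|[|[|[|//]]]] ?] [[|[|[|[|//]]]] ?].
Qed.

Lemma mx_yE (F : numFieldType) : mx_y F = refl_mx F 1.
Proof.
apply/matrixP=> i j; rewrite !mxE.
by case: i j => [[|[|[|[|//]]]] ?] [[|[|[|[|//]]]] ?].
Qed.

Lemma rot_mx0 (F : numFieldType) : rot_mx F 0 = 1%:M.
Proof. by apply/matrixP=> i j; rewrite !mxE addr0 eq_sym. Qed.

Lemma rot_rotM (F : numFieldType) i j :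
  rot_mx F i *m rot_mx F j = rot_mx F (i + j).
Proof. by rewrite fun_mxM; apply: eq_fun_mx => a /=; rewrite addrA. Qed.

Lemma rot_reflM (F : numFieldType) i j :
  rot_mx F i *m refl_mx F j = refl_mx F (j - i).
Proof. by rewrite fun_mxM; apply: eq_fun_mx => a /=; rewrite opprD addrA addrAC. Qed.

Lemma refl_rotM (F : numFieldType) i j :
  refl_mx F i *m rot_mx F j = refl_mx F (i + j).
Proof. by rewrite fun_mxM; apply: eq_fun_mx => a /=; rewrite addrAC. Qed.

Lemma refl_reflM (F : numFieldType) i j :
  refl_mx F i *m refl_mx F j = rot_mx F (j - i).
Proof.
by rewrite fun_mxM; apply: eq_fun_mx => a /=; rewrite opprB addrC addrAC addrA.
Qed.

Lemma tr_rot_mx (F : numFieldType) i : (rot_mx F i)^T = rot_mx F (- i).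
Proof. by apply/matrixP=> a b; rewrite !mxE [in RHS]eq_sym subr_eq. Qed.

Lemma tr_refl_mx (F : numFieldType) i : (refl_mx F i)^T = refl_mx F i.
Proof. by apply/matrixP=> a b; rewrite !mxE eq_sym subr_eq [in RHS]eq_sym subr_eq addrC. Qed.

(** The hypothesis is sharp transitivity: exactly one [f i] sends a to b, so each entry of the sum
    collects a single 1. *)
Lemma sum_fun_mx (F : numFieldType) n (f : 'I_n -> 'I_n -> 'I_n) :
  (forall a b, exists i, forall j, (b == f j a) = (j == i)) ->
  \sum_i fun_mx F (f i) = const_mx 1.
Proof.
move=> fP; apply/matrixP=> a b; rewrite summxE mxE; have [i iP] := fP a b.
rewrite (bigD1 i) //= mxE iP eqxx big1 ?addr0 // => j /negPf ji.
by rewrite mxE iP ji.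
Qed.

Lemma sum_rot_mx (F : numFieldType) : \sum_i rot_mx F i = const_mx 1.
Proof.
apply: sum_fun_mx => a b; exists (b - a) => i.
by rewrite [RHS]eq_sym subr_eq addrC.
Qed.

Lemma sum_refl_mx (F : numFieldType) : \sum_i refl_mx F i = const_mx 1.
Proof.
apply: sum_fun_mx => a b; exists (b + a) => i.
by rewrite eq_sym subr_eq.
Qed.

(* Both sides relate two indices exactly when their difference, or equivalently
   their sum, is congruent to i modulo 2. *)
Lemma rot_refl_add (F : numFieldType) i :
  rot_mx F i + rot_mx F (i + 2) = refl_mx F i + refl_mx F (i + 2).
Proof.
apply/matrixP=> a b; rewrite !mxE.
by case: i a b => [[|[|[|[|//]]]] ?] [[|[|[|[|//]]]] ?] [[|[|[|[|//]]]] ?];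
  rewrite /= ?addr0 ?add0r.
Qed.

Lemma fun_mx_01 (F : numFieldType) n (f : 'I_n -> 'I_n) i j :
  (fun_mx F f i j == 0) || (fun_mx F f i j == 1).
Proof. by rewrite mxE; case: (j == f i); rewrite eqxx ?orbT. Qed.

Lemma grpG_rot (F : numFieldType) i : grpG (rot_mx F i).
Proof.
elim: (nat_of_ord i) {-2}i (erefl (nat_of_ord i)) => [|k IHk] j jE.
  have -> : j = 0 by apply: val_inj.
  by rewrite rot_mx0; apply: in_G_one.
have k4 : (k < 4)%N by rewrite ltnW // -jE.
have -> : j = Ordinal k4 + 1.
  by apply: val_inj; rewrite /= addn1 modn_small -?jE.
by rewrite -rot_rotM -mx_xE; apply: in_G_mul (in_G_x F); apply: IHk.
Qed.

Lemma grpG_refl (F : numFieldType) i : grpG (refl_mx F i).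
Proof.
have -> : refl_mx F i = rot_mx F (1 - i) *m mx_y F.
  by rewrite mx_yE rot_reflM subKr.
exact: in_G_mul (grpG_rot F _) (in_G_y F).
Qed.

(** The rotations and reflections contain 1, x and y, and the multiplication rules above make them
    closed under products and inverses. *)
Lemma grpGP (F : numFieldType) (g : 'M[F]_4) :
  grpG g <-> exists i, g = rot_mx F i \/ g = refl_mx F i.
Proof.
split=> [|[i [->|->]]]; [|exact: grpG_rot|exact: grpG_refl].
elim=> {g} [|||g h _ [i gE] _ [j hE]|g _ [i gE]].
- by exists 0; left; rewrite rot_mx0.
- by exists 1; left; rewrite mx_xE.
- by exists 1; right; rewrite mx_yE.
- case: gE hE => -> [] ->.
  + by exists (i + j); left; rewrite rot_rotM.
  + by exists (j - i); right; rewrite rot_reflM.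
  + by exists (i + j); right; rewrite refl_rotM.
  + by exists (j - i); left; rewrite refl_reflM.
have invE (h : 'M[F]_4) : g *m h = 1%:M -> invmx g = h.
  move=> gh; have [ug _] := mulmx1_unit gh.
  by rewrite -[RHS](mulKmx ug) gh mulmx1.
case: gE => gE.
  by exists (- i); left; apply: invE; rewrite gE rot_rotM subrr rot_mx0.
by exists i; right; apply: invE; rewrite gE refl_reflM subrr rot_mx0.
Qed.

(** Commutation would give i + 1 = i - 1, that is 1 = -1 modulo 4. *)
Lemma refl_mx_x_neq (F : numFieldType) i :
  refl_mx F i *m mx_x F <> mx_x F *m refl_mx F i.
Proof.
by rewrite mx_xE refl_rotM rot_reflM => /fun_mx_inj/(_ 0)/addIr/addrI.
Qed.

Lemma grpKP (F : numFieldType) (g : 'M[F]_4) :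
  grpK g <-> exists i, g = rot_mx F i.
Proof.
split=> [[/grpGP[i [->|->]]]|[i ->]]; first by exists i.
  by move/refl_mx_x_neq.
by split; [exact: grpG_rot | rewrite mx_xE !rot_rotM addrC].
Qed.

Lemma grpGDKP (F : numFieldType) (g : 'M[F]_4) :
  (@grpG F `\` @grpK F)%classic g <-> exists i, g = refl_mx F i.
Proof.
split=> [[/grpGP[i [->|->]] notK]|[i ->]]; last split.
- by case: notK; apply/grpKP; exists i.
- by exists i.
- exact: grpG_refl.
- by case=> _ /refl_mx_x_neq.
Qed.

(** * The doubly regular tournament and its bordered matrix *)

Lemma mulmx_const1 (F : numFieldType) m n p (T : 'M[F]_(m, n)) a :
  (forall i, \sum_j T i j = a) -> T *m (const_mx 1 : 'M_(n, p)) = const_mx a.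
Proof.
move=> rowT; apply/matrixP=> i j; rewrite !mxE -(rowT i).
by apply: eq_bigr => k _; rewrite mxE mulr1.
Qed.

Lemma mul_const1_const1 (F : numFieldType) m n p :
  (const_mx 1 : 'M[F]_(m, n)) *m (const_mx 1 : 'M_(n, p)) = const_mx n%:R.
Proof.
apply: mulmx_const1 => i; under eq_bigr do rewrite mxE.
by rewrite sumr_const card_ord.
Qed.

Lemma rank3_scheme_sum (F : numFieldType) m (A : 'I_3 -> 'M[F]_m) :
  assoc_scheme A -> A 2 = (A 1)^T -> A 1 + (A 1)^T = const_mx 1 - 1%:M.
Proof.
move=> [_ _ _ [A_0 sumA _ _]] A2.
rewrite -sumA !big_ord_recl big_ord0 addr0 -A_0 [RHS]addrC addKr -A2.
by congr (A _ + A _); apply: val_inj.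
Qed.

(* The diagonal of T T^T forces all row sums of the tournament T to be equal, to
   a say; then m = 2 a + 1 and, T T^T being symmetric, T T^T = a I + q (J - I)
   with a = 2 q + 1. *)
Lemma rank3_scheme_params (F : numFieldType) m (A : 'I_3 -> 'M[F]_m) :
  assoc_scheme A -> A 2 = (A 1)^T ->
  exists a : F,
    [/\ m%:R = 2 * a + 1,
        forall p, A 1 *m (const_mx 1 : 'M_(m, p)) = const_mx a,
        forall p, (A 1)^T *m (const_mx 1 : 'M_(m, p)) = const_mx a,
        2 *: (A 1 *m (A 1)^T) = (a + 1)%:M + const_mx (a - 1)
      & (A 1)^T *m A 1 = A 1 *m (A 1)^T].
Proof.
move=> schA A2; have := rank3_scheme_sum schA A2.
have [_ A_neq0 A01 [A_0 _ _ prodA]] := schA; set T := A 1 => TDTt.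
have sumTE i j : (i == j)%:R + T i j + T j i = 1.
  by have /matrixP/(_ i j) := TDTt; rewrite !mxE -addrA => ->; rewrite addrC subrK.
have T01 i j : T i j = 0 \/ T i j = 1.
  by case/orP: (A01 1 i j) => /eqP; [left|right].
have Tii i : T i i = 0.
  have := sumTE i i; rewrite eqxx -addrA -[RHS]addr0 => /addrI/eqP.
  by rewrite -mulr2n mulrn_eq0 /= => /eqP.
have [i0 [j0 Tij0]] : exists i j, T i j = 1.
  case: (pickP (fun ij => T ij.1 ij.2 == 1)) => [[i j] /eqP|T0].
    by exists i, j.
  case/eqP: (A_neq0 1); apply/matrixP => i j; rewrite mxE.
  by case: (T01 i j) => // Tij; have := T0 (i, j); rewrite /= Tij eqxx.
have neq_ij0 : i0 != j0.
  by apply: contra_eqN Tij0 => /eqP <-; rewrite Tii eq_sym oner_eq0.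
have Tji0 : T j0 i0 = 0.
  have := sumTE i0 j0; rewrite (negPf neq_ij0) Tij0 add0r -[RHS]addr0.
  by move/addrI.
(* [T *m T^T] is symmetric while T is not at (i0, j0), which forces equal coefficients on T and its
   transpose. *)
have [a [q TTt]] : exists a q, T *m T^T = a%:M + q *: (T + T^T).
  have [c] := prodA 1 2.
  rewrite A2 !big_ord_recl big_ord0 addr0 A_0.
  have -> : lift ord0 ord0 = 1 :> 'I_3 by apply: val_inj.
  have -> : lift ord0 (lift ord0 ord0) = 2 :> 'I_3 by apply: val_inj.
  rewrite A2 -/T scalemx1 => TTt; exists (c ord0), (c 1).
  suff cE : c 1 = c 2 by rewrite TTt scalerDr -cE.
  have symTTt : T *m T^T = (T *m T^T)^T by rewrite trmx_mul trmxK.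
  move: symTTt; rewrite TTt => /matrixP/(_ i0 j0).
  rewrite !mxE Tij0 Tji0 (negPf neq_ij0) eq_sym (negPf neq_ij0).
  by rewrite !mulr0 !mulr1 !add0r addr0 => ->.
(* Entries are 0 or 1, hence equal to their squares, and the diagonal of [T *m T^T] counts the ones
   of each row. *)
have rowT i : \sum_j T i j = a.
  have /matrixP/(_ i i) := TTt; rewrite !mxE Tii addr0 mulr0 addr0 eqxx mulr1n => <-.
  apply: eq_bigr => j _; rewrite mxE.
  by case: (T01 i j) => ->; rewrite ?mulr0 ?mulr1.
have colT j : \sum_i T i j = m%:R - 1 - a.
  apply: (addIr a); rewrite subrK -{1}(rowT j) -big_split /=.
  apply: (addrI 1); rewrite addrCA subrr addr0.
  transitivity (\sum_(i < m) ((i == j)%:R + T i j + T j i)); last first.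
    under eq_bigr do rewrite sumTE.
    by rewrite sumr_const card_ord.
  under [RHS]eq_bigr do rewrite -addrA.
  rewrite [RHS]big_split /=; congr (_ + _).
  by rewrite (bigD1 j) //= eqxx big1 ?addr0 // => i /negPf ->.
have m_neq0 : m%:R != 0 :> F by rewrite pnatr_eq0 -lt0n (leq_ltn_trans _ (ltn_ord i0)).
(* Counting the ones of T by rows and by columns gives m a = m (m - 1 - a). *)
have mE : m%:R = 2 * a + 1 :> F.
  have : \sum_i \sum_j T i j = \sum_j \sum_i T i j by exact: exchange_big.
  under eq_bigr do rewrite rowT; under [RHS]eq_bigr do rewrite colT.
  rewrite !sumr_const card_ord -[a *+ m]mulr_natr -[_ *+ m in RHS]mulr_natr.
  move=> /(mulIf m_neq0) /eqP.
  by rewrite -addrA -opprD eq_sym subr_eq => /eqP ->; ring.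
have colTa j : \sum_i T i j = a by rewrite colT mE; ring.
(* If a = 0 then m = 1, leaving no room for i0 and j0 to differ. *)
have a_neq0 : a != 0.
  apply/eqP => a0; move: mE; rewrite a0 mulr0 add0r => /eqP; rewrite pnatr_eq1.
  move=> /eqP m1; have ord_eq0 (i : 'I_m) : nat_of_ord i = 0%N.
    by apply/eqP; rewrite -leqn0 -ltnS -[X in (_ < X)%N]m1.
  by case/eqP: neq_ij0; apply: val_inj; rewrite /= !ord_eq0.
have TJ p : T *m (const_mx 1 : 'M_(m, p)) = const_mx a by exact: mulmx_const1.
have TtJ p : T^T *m (const_mx 1 : 'M_(m, p)) = const_mx a.
  by apply: mulmx_const1 => i; under eq_bigr do rewrite mxE.
(* Multiplying the formula for [T *m T^T] by J gives a^2 = a + q (m - 1) = a + 2 q a; then a is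
   cancelled. *)
have aE : a = 2 * q + 1.
  have : T *m T^T *m (const_mx 1 : 'M_(m, m)) = const_mx (a * a).
    have aJ : const_mx a = a *: const_mx 1 :> 'M_(m, m).
      by rewrite scalemx_const mulr1.
    by rewrite -mulmxA TtJ aJ -scalemxAr TJ scalemx_const.
  rewrite TTt mulmxDl mul_scalar_mx -scalemxAl TDTt mulmxBl mul1mx.
  rewrite mul_const1_const1 => /matrixP/(_ i0 i0); rewrite !mxE mE => aaE.
  apply: (mulfI a_neq0); rewrite -aaE; ring.
exists a; split=> //.
  apply/matrixP => i j; rewrite -/T TTt TDTt !mxE aE.
  by case: (i == j); ring.
(* With T^T = J - I - T, the claim reduces to J T = T J, and both sides are a J. *)
rewrite -/T; have -> : T^T = const_mx 1 - 1%:M - T by rewrite -TDTt addrC addKr.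
rewrite mulmxBl mulmxBr mulmxBl mulmxBr mul1mx mulmx1 TJ; congr (_ - _ - _).
by apply: trmx_inj; rewrite trmx_mul trmx_const TtJ trmx_const.
Qed.

(** A blockwise computation: the border blocks need only the constant row and column sums of T, the
    lower right blocks the value of [T *m T^T]. *)
Lemma hatA1_params (F : numFieldType) m (A : 'I_3 -> 'M[F]_m) :
  assoc_scheme A -> A 2 = (A 1)^T ->
  let P := hatA1 (A 1) in let J := const_mx 1 : 'M[F]_(1 + m) in
  [/\ hatA2 (A 2) = P^T,
      P + P^T = J - 1%:M,
      forall i j, (P i j == 0) || (P i j == 1),
      exists i j, P i j = 1 /\ P j i = 0
    & exists a : F,
        P *m P + P^T *m P^T = a *: (J - 1%:M)
        /\ P *m P^T + P^T *m P = m%:R%:M + a *: (J - 1%:M)].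
Proof.
move=> schA A2 P J; have [a [mE TJ TtJ TTt TtT]] := rank3_scheme_params schA A2.
have [_ A_neq0 A01 _] := schA; set T := A 1 in TJ TtJ TTt TtT.
have PtE : P^T = block_mx 0 0 (const_mx 1) T^T.
  by rewrite /P /hatA1 tr_block_mx !trmx0 trmx_const.
have JE : J = block_mx (const_mx 1) (const_mx 1) (const_mx 1) (const_mx 1).
  by rewrite block_mx_const.
have TDTt := rank3_scheme_sum schA A2; rewrite -/T in TDTt.
have J0E : J - 1%:M = block_mx 0 (const_mx 1) (const_mx 1) (T + T^T).
  rewrite JE scalar_mx_block opp_block_mx add_block_mx !oppr0 !addr0 TDTt.
  by congr block_mx; apply/matrixP=> i j; rewrite !mxE !ord1 eqxx subrr.
have m_gt0 : (0 < m)%N.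
  rewrite lt0n; apply: contra (A_neq0 0) => /eqP m0.
  by apply/eqP/matrixP => i; have := ltn_ord i; rewrite {2}m0.
have TtJr p : (const_mx 1 : 'M_(p, m)) *m T^T = const_mx a.
  by apply: trmx_inj; rewrite trmx_mul trmxK !trmx_const TJ.
have TJr p : (const_mx 1 : 'M_(p, m)) *m T = const_mx a.
  by apply: trmx_inj; rewrite trmx_mul !trmx_const TtJ.
have aJ p q : a *: (const_mx 1 : 'M_(p, q)) = const_mx a.
  by rewrite scalemx_const mulr1.
split.
- by rewrite PtE /hatA2 A2 trmx_const.
- by rewrite PtE J0E add_block_mx !addr0 !add0r.
- move=> i j; rewrite /P /hatA1 -(splitK i) -(splitK j).
  case: (split i) => i'; case: (split j) => j' /=;
    rewrite ?block_mxEul ?block_mxEur ?block_mxEdl ?block_mxEdr ?A01 //;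
    by rewrite !mxE eqxx ?orbT.
(* The added vertex dominates every old one, and m > 0 provides an old one. *)
- exists (lshift m 0), (rshift 1 (Ordinal m_gt0)).
  by rewrite /P /hatA1 block_mxEur block_mxEdl !mxE.
exists a; rewrite PtE J0E /P /hatA1 -/T !mulmx_block !add_block_mx.
rewrite scale_block_mx !mulmx0 !mul0mx !addr0 !add0r !TJ !TtJ !TJr !TtJr.
rewrite !mul_const1_const1 scaler0 !aJ TDTt scalar_mx_block add_block_mx !add0r.
(* The squares are what remains of (T + T^T)^2 = (J - I)^2 after removing the two equal mixed
   products. *)
have TTt2 : T *m T + T^T *m T^T = a *: (const_mx 1 - 1%:M).
  have <- : (T + T^T) *m (T + T^T) - 2 *: (T *m T^T) = T *m T + T^T *m T^T.
    rewrite mulmxDl !mulmxDr TtT.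
    move: (T *m T) (T *m T^T) (T^T *m T^T) => X Y Z.
    by apply/matrixP=> i j; rewrite !mxE; ring.
  rewrite TTt TDTt mulmxBl !mulmxBr !mulmx1 mul1mx mul_const1_const1 mE.
  by apply/matrixP => i j; rewrite !mxE; case: (i == j); ring.
split; first by rewrite TTt2.
congr (block_mx _ _ _ _).
  by rewrite addr0; apply/matrixP => i j; rewrite !mxE !ord1.
rewrite TtT addrCA -mulr2n -scaler_nat TTt mE.
by apply/matrixP => i j; rewrite !mxE; case: (i == j); ring.
Qed.

(** * Numbering and verification of the scheme *)

Lemma tau_reflE (F : numFieldType) m (A1 A2 : 'M[F]_m) k :
  tau A1 A2 (refl_mx F k) =
    hatA1 A1 *t refl_mx F k + hatA2 A2 *t refl_mx F (k + 2).
Proof. by rewrite /tau mx_xE rot_rotM refl_rotM. Qed.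

(** Rotations come first so that index 0 falls on the identity, as [assoc_scheme] demands. *)
Definition schemeQ_elt (F : numFieldType) m (A1 A2 : 'M[F]_m) (i : 'I_(4 + 4)) :=
  match split i with
  | inl k => sigma m (rot_mx F k)
  | inr k => tau A1 A2 (refl_mx F k)
  end.

Lemma schemeQ_eltl (F : numFieldType) m (A1 A2 : 'M[F]_m) k :
  schemeQ_elt A1 A2 (lshift 4 k) = sigma m (rot_mx F k).
Proof. by rewrite /schemeQ_elt (unsplitK (inl k)). Qed.

Lemma schemeQ_eltr (F : numFieldType) m (A1 A2 : 'M[F]_m) k :
  schemeQ_elt A1 A2 (rshift 4 k) = tau A1 A2 (refl_mx F k).
Proof. by rewrite /schemeQ_elt (unsplitK (inr k)). Qed.

Lemma range_schemeQ_elt (F : numFieldType) m (A1 A2 : 'M[F]_m) :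
  range (schemeQ_elt A1 A2) = schemeQ A1 A2.
Proof.
apply/seteqP; split=> [_ [i _ <-]|M].
  rewrite /schemeQ_elt; case: (@split 4 4 i) => k; [left|right].
    by exists (rot_mx F k) => //; apply/grpKP; exists k.
  by exists (refl_mx F k) => //; apply/grpGDKP; exists k.
case=> [[g /grpKP[k ->] <-]|[g /grpGDKP[k ->] <-]].
  by exists (lshift 4 k); rewrite ?schemeQ_eltl.
by exists (rshift 4 k); rewrite ?schemeQ_eltr.
Qed.

Theorem theorem3p10 (F : numFieldType) (m : nat) (A : 'I_3 -> 'M[F]_m)
    (A_scheme : assoc_scheme A)
    (A_nonsym : ~ symmetric_scheme A)
    (A2_tr : A 2 = (A 1)^T) :
  is_assoc_scheme (schemeQ (A 1) (A 2)).
Proof.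
have [] := hatA1_params A_scheme A2_tr.
set P := hatA1 _; set J := const_mx 1.
move=> hatA2E PDPt P01 [u [v [Puv Pvu]]] [a [PP PPt]].
pose Q : 'I_7.+1 -> _ := schemeQ_elt (A 1) (A 2).
have tauE k : tau (A 1) (A 2) (refl_mx F k)
    = P *t refl_mx F k + P^T *t refl_mx F (k + 2).
  by rewrite tau_reflE hatA2E.
(* From here on P enters only through the relations of [hatA1_params], no longer through its block
   shape. *)
clearbody P.
have Q_sigma k : lin_comb Q (sigma m (rot_mx F k)).
  by rewrite -(schemeQ_eltl (A 1) (A 2)); apply: (lin_comb_gen Q).
have Q_tau k : lin_comb Q (tau (A 1) (A 2) (refl_mx F k)).
  by rewrite -schemeQ_eltr; apply: (lin_comb_gen Q).
have k22 (k : 'I_4) : k + 2 + 2 = k.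
  by rewrite -addrA -[RHS]addr0; congr (_ + _); apply: val_inj.
have N2 : - 2 = 2 :> 'I_4 by apply: val_inj.
(* The sigmas add up to I (x) J and the taus to (P + P^T) (x) J = (J - I) (x) J. *)
have sumQ : \sum_i Q i = const_mx 1.
  transitivity (\sum_i sigma m (rot_mx F i)
                + \sum_i tau (A 1) (A 2) (refl_mx F i)).
    rewrite -(eq_bigr _ (fun k _ => schemeQ_eltl (A 1) (A 2) k)).
    rewrite -(eq_bigr _ (fun k _ => schemeQ_eltr (A 1) (A 2) k)).
    exact: (@big_split_ord _ _ _ 4 4).
  rewrite (eq_bigr _ (fun k _ => tauE k)) big_split /= !tensmx_sumr.
  rewrite sum_rot_mx sum_refl_mx.
  have -> : \sum_i refl_mx F (i + 2) = const_mx 1.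
    by rewrite -sum_refl_mx [RHS](reindex_inj (addIr 2)).
  by rewrite -!tensmxDl PDPt addrC subrK tens_const_mx mulr1.
have P_asym i j : P i j = 1 -> P j i = 0.
  move=> Pij; have /matrixP/(_ i j) := PDPt; rewrite !mxE Pij => /addrI Pji.
  case/orP: (P01 j i) Pji => /eqP-> // /eqP; rewrite -addr_eq0 nat1r.
  by rewrite pnatr_eq0.
(* P and P^T have disjoint supports, so an entry of a tau is 0 or an entry of one permutation
   matrix. *)
have Q01 i b c : (Q i b c == 0) || (Q i b c == 1).
  rewrite /Q /schemeQ_elt; case: (@split 4 4 i) => k.
    by rewrite !mxE -natrM mulnb; case: (_ && _); rewrite eqxx ?orbT.
  rewrite tauE mxE ![(_ *t _) _ _]mxE [P^T _ _]mxE.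
  set b1 := (mxtens_unindex b).1; set c1 := (mxtens_unindex c).1.
  case/orP: (P01 b1 c1) => /eqP Pbc; last first.
    by rewrite Pbc (P_asym _ _ Pbc) mul1r mul0r addr0 fun_mx_01.
  rewrite Pbc mul0r add0r; case/orP: (P01 c1 b1) => /eqP ->.
    by rewrite mul0r eqxx.
  by rewrite mul1r fun_mx_01.
(* [rot_mx F k] and [refl_mx F k] both have a 1 at (0, k); at (u, v), P is 1 and P^T is 0, so
   nothing is added to it. *)
have Q_neq0 i : Q i != 0.
  apply/eqP; rewrite /Q /schemeQ_elt; case: (@split 4 4 i) => k /matrixP.
    move/(_ (mxtens_index (u, 0)) (mxtens_index (u, k))).
    by rewrite tensmxE !mxE eqxx add0r eqxx mulr1; apply/eqP/oner_neq0.
  move/(_ (mxtens_index (u, 0)) (mxtens_index (v, k))).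
  rewrite tauE mxE !tensmxE [P^T _ _]mxE Puv Pvu !mxE subr0 eqxx.
  by rewrite mul0r addr0 mulr1; apply/eqP/oner_neq0.
exists 7, Q; split; first exact: range_schemeQ_elt.
split=> //; first exact: sum_const1_injective.
split=> //.
- have -> : ord0 = lshift 4 ord0 :> 'I_(4 + 4) by apply: val_inj.
  by rewrite /Q schemeQ_eltl rot_mx0 /sigma tens1mx1.
- move=> i; rewrite {2}/Q /schemeQ_elt; case: (@split 4 4 i) => k.
    by rewrite /sigma trmx_tens trmx1 tr_rot_mx; apply: Q_sigma.
  (* Reflections are symmetric, so transposing swaps P and P^T and sends index k to k + 2. *)
  rewrite tauE raddfD /= !trmx_tens !tr_refl_mx trmxK.
  rewrite addrC -{2}(k22 k) -tauE.
  exact: Q_tau.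
- move=> i j; rewrite {2 3}/Q /schemeQ_elt.
  case: (@split 4 4 i) => k; case: (@split 4 4 j) => l.
  + by rewrite tensmx_mul mul1mx rot_rotM; apply: Q_sigma.
  + rewrite tauE mulmxDr !tensmx_mul !mul1mx !rot_reflM addrAC -tauE.
    exact: Q_tau.
  + rewrite tauE mulmxDl !tensmx_mul !mulmx1 !refl_rotM addrAC -tauE.
    exact: Q_tau.
  + rewrite !tauE mulmxDl !mulmxDr !tensmx_mul !refl_reflM.
    have -> : l + 2 - k = l - k + 2 by rewrite addrAC.
    have -> : l - (k + 2) = l - k + 2 by rewrite opprD N2 addrA.
    have -> : l + 2 - (k + 2) = l - k by rewrite opprD addrACA subrr addr0.
    (* With r = l - k, the products P P and P^T P^T carry x^r, and the mixed ones x^(r + 2), since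
       -2 = 2 modulo 4. *)
    move: (l - k) => r; rewrite [X in _ + X]addrC addrACA -!tensmxDl.
    rewrite PP PPt tensmxDl addrCA -scalemx1 !tensmxZl -scalerDr -tensmxDr.
    (* Trading the rotations r and r + 2 for reflections and J - I for P + P^T leaves four terms,
       which pair up into tau at r and tau at r + 2. *)
    rewrite rot_refl_add -PDPt tensmxDl !tensmxDr.
    rewrite [P^T *t _ + _]addrC [X in _ + _ *: X]addrACA -tauE.
    rewrite -[in P^T *t refl_mx F r](k22 r) -tauE.
    apply: lin_combD; apply: lin_combZ; first exact: Q_sigma.
    by apply: lin_combD.
Qed.
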